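(* Let $R=(R,C)$ be a finite based $\mathbb{R}_{\geq 0}$-algebra with basis $C=\{1=c_0,\dots,c_{r-1}\}$, and let $c=a_0c_0+\dots+a_{r-1}c_{r-1}$ with all $a_i\in\mathbb{R}_{\geq 0}$. Let $M=M(c)$ be the action matrix of $c$, let $\lambda=\mathrm{PFdim}\,c$ be its Perron--Frobenius eigenvalue, and assume $\lambda>0$. Let $h$ be the least common multiple of the periods of $M$, let $\zeta=\exp(2\pi i/h)$, and let $S^0(n),\dots,S^{h-1}(n)$ be the matrices with polynomial entries associated to $M$ as defined in the context. Write $S^j(n)[1]$ for the sum of the entries of the first column (the column indexed by $c_0=1$) of $S^j(n)$, and put $$a(n)=\lambda^n\cdot\frac1h\sum_{i=0}^{h-1}\sum_{j=0}^{h-1}S^j\big(\lfloor n/h\rfloor\big)[1]\cdot\zeta^{i(n-j)} .$$ Then $$b^{R,c}(n)\sim a(n),$$ and the convergence is geometric with ratio $|\lambda^{sec}/\mathrm{PFdim}\,c|$, where $\lambda^{sec}$ is any second largest eigenvalue of $M(c)$. In particular, $$\lim_{n\to\infty}\sqrt[n]{b^{R,c}(n)}=\mathrm{PFdim}\,c .$$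
   Context: Let $\mathbb{K}\subset\mathbb{C}$ be a unital subring. A finite based $\mathbb{R}_{\geq 0}$-algebra is a (unital, associative) $\mathbb{K}$-algebra $R$ together with a finite $\mathbb{K}$-basis $C=\{1=c_0,\dots,c_{r-1}\}$ containing the unit, such that $c_ic_j=\sum_k m_{i,j}^k c_k$ with all $m_{i,j}^k\in\mathbb{R}_{\geq 0}$. For $c=\sum_i a_ic_i$ with $a_i\in\mathbb{R}_{\geq 0}$, write $c^n=\sum_k m_n^k(c)\,c_k$ and set $b^{R,c}(n)=b_n^{R,c}=\sum_k m_n^k(c)$ (the total sum of the coefficients of $c^n$ in the basis $C$). The pre action matrix of $c$ is the $r\times r$ matrix $M'(c)$ with entries $M'(c)_{k,j}=\sum_i a_im_{i,j}^k$ (so column $j$ contains the coefficients of $c\,c_j$). Its adjacency graph is the weighted oriented graph on the index set with an edge of weight $M'(c)_{k,j}$ from $k$ to $j$ (whenever nonzero). The action matrix $M(c)$ is the submatrix of $M'(c)$ whose rows and columns are indexed by the connected component, in the nonoriented sense, of the vertex $c_0=1$; $c_0$ is kept as the first index. Perron--Frobenius data of a square matrix $M$ with entries in $\mathbb{R}_{\geq 0}$ (known facts): $M$ has a Perron--Frobenius eigenvalue $\lambda\in\mathbb{R}_{\geq 0}$, i.e. an eigenvalue with $\lambda\geq|\mu|$ for all other eigenvalues $\mu$; assume $\lambda>0$. If $s$ is the multiplicity of $\lambda$, there are integers $h_1,\dots,h_s\geq1$, the periods, such that the eigenvalues $\mu$ with $|\mu|=\lambda$ are the numbers $\exp(2\pi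 i k/h_\ell)\lambda$ with $\ell\in\{1,\dots,s\}$, $k\in\{0,\dots,h_\ell-1\}$. Let $h=\mathrm{lcm}(h_1,\dots,h_s)$, and let $\nu$ be the maximal dimension of the Jordan blocks of $M$ with eigenvalue $\lambda$. Then for each $i\in\{0,\dots,h-1\}$ there is a (unique) matrix $S^i(n)$ whose entries are polynomials in $n$ of degree $\leq\nu-1$ such that $\lim_{n\to\infty}|(M/\lambda)^{hn+i}-S^i(n)|=0$ entrywise. ''Second largest eigenvalue'' $\lambda^{sec}$: an eigenvalue of $M(c)$ of largest absolute value among those of absolute value strictly smaller than $\mathrm{PFdim}\,c$ (take $\lambda^{sec}=0$ if there is none). $f(n)\sim g(n)$ means $f(n)/g(n)\to1$ as $n\to\infty$. A sequence $f(n)$ converges geometrically to $a$ with ratio $\beta\in[0,1)$ if for all $\gamma\in(\beta,1)$ the sequence $(f(n)-a)/\gamma^n$ is bounded; here this is applied to $b^{R,c}(n)/a(n)\to 1$ (for $n$ large enough that $a(n)\neq0$). *)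

(* Defs.v *)
From HB Require Import structures.
From mathcomp Require Import all_boot all_order all_algebra.
From mathcomp Require Import complex.
From mathcomp Require Import all_classical all_reals all_analysis.

Set Implicit Arguments.
Unset Strict Implicit.
Unset Printing Implicit Defensive.

Import Order.TTheory GRing.Theory Num.Theory.
Import numFieldNormedType.Exports.

Local Open Scope classical_set_scope.
Local Open Scope ring_scope.
Local Open Scope complex_scope.

(* The usual topology of the complex numbers, as a normed module over itself;
   the norm takes its (real) values in R[i]. *)
HB.instance Definition _ (R : realType) := NormedModule.copy R[i] R[i]^o.

Section Subring.
Variables (R : realType) (K : subringClosed R[i]).

Record subring_of := SubringOf {
  subring_val :> R[i];
  subring_valP : subring_val \in K }.

HB.instance Definition _ := [isSub for subring_val].
HB.instance Definition _ := [Choice of subring_of by <:].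
HB.instance Definition _ := [SubChoice_isSubComNzRing of subring_of by <:].

(* A finite based algebra over K with nonnegative structure constants.
   [ba_coord x k] is the coefficient of [ba_basis k] in x; the first two axioms
   say that the family is a K-basis.  In the order of R[i], [0 <= z] means
   that z is real and nonnegative. *)
Record basedAlgebra := BasedAlgebra {
  ba_rank : nat;
  ba_alg :> algType subring_of;
  ba_basis : 'I_ba_rank.+1 -> ba_alg;
  ba_coord : ba_alg -> 'I_ba_rank.+1 -> subring_of;
  ba_coordK : forall x : ba_alg, x = \sum_k ba_coord x k *: ba_basis k;
  ba_coord_sum : forall (a : 'I_ba_rank.+1 -> subring_of) k,
    ba_coord (\sum_i a i *: ba_basis i) k = a k;
  ba_basis0 : ba_basis ord0 = 1;
  ba_coord_ge0 : forall i j k,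
    0 <= (ba_coord (ba_basis i * ba_basis j) k : R[i]) }.
End Subring.

Arguments ba_basis {R K} b _.

Section ActionMatrix.
Variables (R : realType) (K : subringClosed R[i]) (A : basedAlgebra K).
Implicit Type c : A.

Definition pow_coord_sum c (n : nat) : R[i] := val (\sum_k ba_coord (c ^+ n) k).

Definition pre_action_mx c : 'M[R[i]]_((ba_rank A).+1) :=
  \matrix_(k, j) val (\sum_i
    ba_coord c i * ba_coord (ba_basis A i * ba_basis A j) k).

Definition edge_sym c : rel 'I_(ba_rank A).+1 :=
  fun k j => (pre_action_mx c k j != 0) || (pre_action_mx c j k != 0).

Definition component1 c : {set 'I_(ba_rank A).+1} :=
  [set j | connect (edge_sym c) ord0 j].

Lemma component1_ord0 c : ord0 \in component1 c.
Proof. by rewrite inE connect0. Qed.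

Definition action_mx c : 'M[R[i]]_#|component1 c| :=
  mxsub enum_val enum_val (pre_action_mx c).

(* The position of c_0 in the component; [enum_val] is increasing, so this is
   the first index. *)
Definition action_idx1 c : 'I_#|component1 c| :=
  enum_rank_in (component1_ord0 c) ord0.
End ActionMatrix.

Section PerronFrobenius.
Variables (R : realType) (d : nat).
Implicit Types (M : 'M[R[i]]_d) (lam : R) (mu : R[i]).

Definition expi (t : R) : R[i] := cos t +i* sin t.

Definition PF_eigenvalue M lam : Prop :=
  [/\ 0 <= lam, eigenvalue M lam%:C
    & forall mu, eigenvalue M mu -> `|mu| <= lam%:C].

(* The multiplicity is the algebraic one.  The last clause does not
   determine [hs] as a multiset, but it does determine the lcm of [hs]: this is
   the lcm of the orders of the roots of unity mu / lam. *)
Definition PF_periods M lam (hs : seq nat) : Prop :=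
  [/\ size hs = mup lam%:C (char_poly M),
      all (leq 1) hs
    & forall mu, (eigenvalue M mu /\ `|mu| = lam%:C) <->
        exists l k : nat, [/\ l \in hs, (k < l)%N
          & mu = expi (2 * pi * k%:R / l%:R) * lam%:C]].

Definition PF_period (hs : seq nat) : nat := \big[lcmn/1%N]_(l <- hs) l.

Definition jordan_block (p : nat) mu : 'M[R[i]]_p :=
  \matrix_(i, j) (if i == j then mu else (i.+1 == j)%:R).

Definition jordan_form M (k : nat) (p : 'I_k -> nat) (e : 'I_k -> R[i]) : Prop :=
  (forall i, 0 < p i)%N /\
  exists (P : 'M[R[i]]_(d, \sum_i p i)) (Q : 'M[R[i]]_(\sum_i p i, d)),
    [/\ P *m Q = 1%:M, Q *m P = 1%:M
      & M = P *m (\mxdiag_i jordan_block (p i) (e i)) *m Q].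

Definition max_jordan_dim M mu (nu : nat) : Prop :=
  exists (k : nat) (p : 'I_k -> nat) (e : 'I_k -> R[i]),
    jordan_form M p e /\ nu = \max_(i < k | e i == mu) p i.

(* Degree at most nu - 1 is [size _ <= nu], where nu >= 1. *)
Definition PF_limit_polys M lam (nu h : nat) (S : 'I_h -> 'M[{poly R[i]}]_d) :
    Prop :=
  forall (i : 'I_h) k l,
    (size (S i k l) <= nu)%N /\
    (fun n : nat =>
       `|((lam%:C^-1 *: M) ^+ (h * n + i)) k l - (S i k l).[n%:R]|)
      @ \oo --> (0 : R[i]).

Definition second_eigenvalue M lam (lsec : R[i]) : Prop :=
  [/\ eigenvalue M lsec, `|lsec| < lam%:C
    & forall mu, eigenvalue M mu -> `|mu| < lam%:C -> `|mu| <= `|lsec|]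
  \/ (lsec = 0 /\ forall mu, eigenvalue M mu -> ~ `|mu| < lam%:C).

Definition col_sum_at (S : 'M[{poly R[i]}]_d) (j0 : 'I_d) (n : nat) : R[i] :=
  \sum_k (S k j0).[n%:R].

Definition asymp_seq lam (h : nat) (S : 'I_h -> 'M[{poly R[i]}]_d) (j0 : 'I_d)
    (n : nat) : R[i] :=
  lam%:C ^+ n * (h%:R^-1 * \sum_(i < h) \sum_(j < h)
    col_sum_at (S j) j0 (n %/ h)
      * expi (2 * pi / h%:R) ^ (i%:Z * (n%:Z - j%:Z))).
End PerronFrobenius.

Section Asymptotics.
Variable R : realType.

(* As x / 0 = 0, this forces g to be eventually nonzero. *)
Definition asymp_equiv (f g : nat -> R[i]) : Prop :=
  (fun n => f n / g n) @ \oo --> (1 : R[i]).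

(* In the order of R[i], the inequalities below force beta and gamma to be real.
   Boundedness is required for n large enough only, so that finitely many
   values [f n] that are not meaningful do not matter. *)
Definition cvg_geometrically (f : nat -> R[i]) (l beta : R[i]) : Prop :=
  0 <= beta < 1 /\
  forall gamma : R[i], beta < gamma < 1 ->
    bounded_near (fun n => (f n - l) / gamma ^+ n) \oo.
End Asymptotics.

(* Main.v *)
(* Write t(n) = b(n) / lam^n and s(n) = a(n) / lam^n; summing the roots of unity
   gives s(n) = S^{n mod h}(n / h)[1], so t - s tends to 0.
   Since c^n c_j is bounded by a constant times c^n, every column sum of M^n is
   at most a constant times b(n); testing M^n on a left eigenvector for lam then
   bounds t(n) away from 0, whence b ~ a.
   For the rate, fix n mod h.  By Cayley-Hamilton and because S^i is polynomial,
   t - s is annihilated, as a sequence in m = n / h, by a product of operators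
   E - z, where E is the shift and z is 1 or (mu / lam)^h for an eigenvalue mu.
   Inverting a factor with |z| < q preserves the bound O(q^m); so does inverting
   one with |z| = 1 > q, because the sequence tends to 0. *)
Require Import Defs.
From HB Require Import structures.
From mathcomp Require Import all_boot all_order all_algebra.
From mathcomp Require Import complex ring lra.
From mathcomp Require Import all_classical all_reals all_analysis.

Set Implicit Arguments.
Unset Strict Implicit.
Unset Printing Implicit Defensive.

Import Order.TTheory GRing.Theory Num.Theory.
Import numFieldNormedType.Exports.

Local Open Scope classical_set_scope.
Local Open Scope ring_scope.
Local Open Scope complex_scope.

(** * Linear recurrences, through the operators E - z where E is the shift *)

Section LinearRecurrences.
Variable F : numFieldType.
Implicit Types (z g : F) (zs : seq F) (w : nat -> F) (p : {poly F}).

Definition rec_op z w : nat -> F := fun n => w n.+1 - z * w n.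

Definition rec_ops zs w : nat -> F := foldl (fun w z => rec_op z w) w zs.

(** The bound holds from n = 0 on, which forces [B] to be nonnegative. *)
Definition geom_bounded g w := exists B : F, forall n, `|w n| <= B * g ^+ n.

Lemma rec_opB z w1 w2 :
  rec_op z (fun n => w1 n - w2 n) = fun n => rec_op z w1 n - rec_op z w2 n.
Proof. by apply/funext => n; rewrite /rec_op; ring. Qed.

Lemma rec_opsB zs w1 w2 :
  rec_ops zs (fun n => w1 n - w2 n) = fun n => rec_ops zs w1 n - rec_ops zs w2 n.
Proof. by elim: zs w1 w2 => //= z zs IH w1 w2; rewrite rec_opB IH. Qed.

Lemma rec_op_poly z p :
  rec_op z (fun n => p.[n%:R]) = fun n => (p \Po ('X + 1%:P) - z *: p).[n%:R].
Proof.
by apply/funext => n; rewrite /rec_op !hornerE horner_comp !hornerE -natr1.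
Qed.

Lemma rec_ops_poly zs p :
  exists q, rec_ops zs (fun n => p.[n%:R]) = fun n => q.[n%:R].
Proof.
elim: zs p => [|z zs IH] p; first by exists p.
by rewrite /= rec_op_poly; apply: IH.
Qed.

(** E - 1 lowers the degree, because p(X + 1) and p have the same leading term. *)
Lemma rec_ops_poly0 p (k : nat) : (size p <= k)%N ->
  rec_ops (nseq k 1) (fun n => p.[n%:R]) = fun=> 0.
Proof.
elim: k p => [|k IH] p sp /=.
  apply/funext => n; move: sp; rewrite leqn0 size_poly_eq0 => /eqP ->.
  by rewrite horner0.
rewrite rec_op_poly scale1r; apply: IH.
have sX : size ('X + 1%:P : {poly F}) = 2.
  by rewrite size_polyDl ?size_polyX // size_polyC oner_eq0.
have lX : lead_coef ('X + 1%:P : {poly F}) = 1.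
  by rewrite lead_coefDl ?lead_coefX // size_polyX size_polyC oner_eq0.
have sc := size_comp_poly2 p sX.
(* Above k both coefficients vanish; at k they are both zero or both the leading coefficient of
   p. *)
apply/leq_sizeP => j kj; rewrite coefB.
have [jk|jk] := ltnP k j.
  rewrite !nth_default ?subr0 ?sc //; exact: leq_trans sp jk.
have -> : j = k by apply/eqP; rewrite eqn_leq jk kj.
have [sk|sk] := eqVneq (size p) k.+1; last first.
  have {}sp : (size p <= k)%N by rewrite -ltnS ltn_neqAle sk sp.
  by rewrite !nth_default ?subr0 ?sc.
have := lead_coef_comp p (q := 'X + 1%:P); rewrite sX lX expr1n mulr1 => /(_ isT).
by rewrite /lead_coef sc sk /= => ->; rewrite subrr.
Qed.

(** Forward induction on w(n+1) = (E - z)w(n) + z w(n): the constant C chosen below satisfies B +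
    |z| C <= g C and C >= |w(0)|. *)
Lemma geom_bounded_rec_op_lt z g w : 0 < g -> `|z| < g ->
  geom_bounded g (rec_op z w) -> geom_bounded g w.
Proof.
move=> g0 zg [B wB]; have d0 : 0 < g - `|z| by rewrite subr_gt0.
have B0 : 0 <= B by have := wB 0; rewrite expr0 mulr1; apply: le_trans.
exists (`|w 0| + B / (g - `|z|)); elim=> [|n IH].
  by rewrite expr0 mulr1 lerDl divr_ge0 // ltW.
have -> : w n.+1 = rec_op z w n + z * w n by rewrite /rec_op subrK.
apply: le_trans (ler_normD _ _) _; rewrite normrM.
apply: le_trans (lerD (wB n) (ler_wpM2l (normr_ge0 z) IH)) _.
rewrite -subr_ge0 exprS.
rewrite (_ : _ - _ = `|w 0| * (g - `|z|) * g ^+ n).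
  by rewrite !mulr_ge0 ?exprn_ge0 // ltW.
by field; rewrite gt_eqF.
Qed.

(* Solving for [w n] backwards bounds it by a geometric tail. *)
Lemma geom_bounded_rec_op_unit z g w : 0 < g < 1 -> `|z| = 1 ->
  w @ \oo --> 0 -> geom_bounded g (rec_op z w) -> geom_bounded g w.
Proof.
move=> /andP[g0 g1] z1 w0 [B wB]; have d0 : 0 < 1 - g by rewrite subr_gt0.
have B0 : 0 <= B by have := wB 0; rewrite expr0 mulr1; apply: le_trans.
exists (B / (1 - g)) => n; apply/ler_addgt0Pr => e e0.
(* The last term is B (g^n + ... + g^(n+m-1)) in closed form; each backward step adds one summand,
   since |z| = 1. *)
have tail m : `|w n| <= `|w (n + m)%N| + B / (1 - g) * (g ^+ n - g ^+ (n + m)).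
  elim: m => [|m IH]; first by rewrite addn0 subrr mulr0 addr0.
  apply: le_trans IH _.
  have H : `|w (n + m)%N| <= `|w (n + m.+1)%N| + B * g ^+ (n + m).
    have <- : `|z * w (n + m)%N| = `|w (n + m)%N| by rewrite normrM z1 mul1r.
    have -> : z * w (n + m)%N = w (n + m.+1)%N - rec_op z w (n + m).
      by rewrite /rec_op addnS opprB addrC subrK.
    by apply: le_trans (ler_normB _ _) _; rewrite lerD2l.
  apply: le_trans (lerD H (lexx _)) _; rewrite -addrA lerD2l addnS exprS le_eqVlt.
  by apply/orP; left; apply/eqP; field; rewrite gt_eqF.
move/cvgrPdist_lt : w0 => /(_ _ e0)[N _ HN].
apply: le_trans (tail N) _.
rewrite addrC lerD //.
  apply: ler_wpM2l; first by rewrite divr_ge0 // ltW.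
  by rewrite lerBlDr lerDl exprn_ge0 // ltW.
have := HN (n + N)%N (leq_addl _ _).
by rewrite sub0r normrN => /ltW.
Qed.

(** The factors are inverted one at a time, starting from the zero sequence. Convergence to 0 passes
    from w to (E - z)w, so it is available at every factor of modulus 1. *)
Lemma geom_bounded_rec_ops zs g w : 0 < g ->
  (forall z, z \in zs ->
     `|z| < g \/ [/\ `|z| = 1, g < 1 & w @ \oo --> 0]) ->
  rec_ops zs w = (fun=> 0) -> geom_bounded g w.
Proof.
move=> g0; elim: zs w => [|z zs IH] w /= Hz.
  by move=> ->; exists 0 => n; rewrite normr0 mul0r.
move=> /IH wz; have {wz} : geom_bounded g (rec_op z w).
  apply: wz => y yzs; have yz : y \in z :: zs by rewrite inE yzs orbT.
  have [yg|[y1 g1 w0]] := Hz y yz; first by left.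
  right; split=> //; rewrite -[0](subr0 0) -[in X in _ - X](mulr0 z).
  by apply: cvgB; [rewrite (cvg_shiftS w) | apply: cvgMr].
have [zg|[z1 g1 w0]] := Hz z (mem_head _ _).
  exact: geom_bounded_rec_op_lt.
by apply: geom_bounded_rec_op_unit => //; rewrite g0.
Qed.

Lemma geom_bounded_residues (h : nat) g w : (0 < h)%N -> 0 < g ->
  (forall i : 'I_h, geom_bounded (g ^+ h) (fun n => w (h * n + i)%N)) ->
  geom_bounded g w.
Proof.
move=> h0 g0 /choice[B HB].
have B0 i : 0 <= B i by have := HB i 0; rewrite expr0 mulr1; apply: le_trans.
(* Dividing by g^i turns the bound g^(h (n / h)) on the class of i into g^n; the sum dominates the
   constants of all classes. *)
exists (\sum_i B i / g ^+ i) => n.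
pose r := Ordinal (ltn_pmod n h0).
have nE : n = (h * (n %/ h) + r)%N by rewrite mulnC; apply: divn_eq.
rewrite {1}nE; apply: le_trans (HB r _) _; rewrite -exprM.
have -> : B r * g ^+ (h * (n %/ h)) = B r / g ^+ r * g ^+ n.
  by rewrite [in RHS]nE exprD mulrA mulrAC mulfVK // expf_neq0 // gt_eqF.
apply: ler_wpM2r; first exact/exprn_ge0/ltW.
rewrite (bigD1 r) //= lerDl.
by rewrite sumr_ge0 // => i _; rewrite divr_ge0 // exprn_ge0 // ltW.
Qed.

End LinearRecurrences.

(** * Recurrences satisfied by linear forms of matrix powers *)

Section MatrixRecurrences.
Variables (F : numFieldType) (d : nat) (f : {scalar 'M[F]_d.+1}).
Implicit Types (M X Y : 'M[F]_d.+1) (zs : seq F).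

(** On the sequence f(X Y^n), applying E - z amounts to replacing X by X (Y - z). *)
Lemma rec_ops_mx zs X Y :
  rec_ops zs (fun n => f (X * Y ^+ n)) =
  fun n => f (X * horner_mx Y (\prod_(z <- zs) ('X - z%:P)) * Y ^+ n).
Proof.
elim: zs X => [|z s IH] X /=.
  by rewrite big_nil rmorph1 mulr1.
have -> : rec_op z (fun n => f (X * Y ^+ n)) =
    (fun n => f (X * (Y - z%:M) * Y ^+ n)).
  apply/funext => n; rewrite /rec_op exprS mulrBr mulrBl linearB /= !mulrA.
  congr (_ - _); rewrite -[RHS]/(f (X *m z%:M *m Y ^+ n)).
  by rewrite scalar_mxC mul_scalar_mx -scalemxAl linearZ.
rewrite IH big_cons rmorphM /= rmorphB /= horner_mx_X horner_mx_C.
by apply/funext => n; rewrite !mulrA.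
Qed.

(** X - z divides X^h - z^h, so evaluating the product at M^h gives a multiple of the characteristic
    polynomial at M, which is 0 by Cayley-Hamilton. *)
Lemma horner_mx_roots_exp (h : nat) zs M :
  char_poly M = \prod_(z <- zs) ('X - z%:P) ->
  horner_mx (M ^+ h) (\prod_(z <- [seq z ^+ h | z <- zs]) ('X - z%:P)) = 0.
Proof.
move=> Mzs; rewrite big_map.
have -> : horner_mx (M ^+ h) (\prod_(z <- zs) ('X - (z ^+ h)%:P)) =
    horner_mx M (\prod_(z <- zs) ('X ^+ h - z%:P ^+ h)).
  rewrite !rmorph_prod; apply: eq_bigr => z _.
  by rewrite !rmorphB /= !rmorphXn /= !horner_mx_X !horner_mx_C.
under eq_bigr do rewrite subrXX.
by rewrite big_split /= -Mzs rmorphM /= Cayley_Hamilton mul0r.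
Qed.

Lemma rec_ops_char_poly (h i : nat) zs M :
  char_poly M = \prod_(z <- zs) ('X - z%:P) ->
  rec_ops [seq z ^+ h | z <- zs] (fun n => f (M ^+ (h * n + i))) = fun=> 0.
Proof.
move=> /(horner_mx_roots_exp h) M0.
have -> : (fun n => f (M ^+ (h * n + i))) = fun n => f (M ^+ i * (M ^+ h) ^+ n).
  by apply/funext => n; rewrite addnC exprD exprM.
by rewrite rec_ops_mx M0; apply/funext => n; rewrite mulr0 mul0r linear0.
Qed.
End MatrixRecurrences.

(** * Growth and decay of column sums, read off the spectrum *)

Section SpectralBounds.
Variable R : realType.
Implicit Types (d : nat) (lam : R) (g mu : R[i]).

(** Its linearity, registered below, lets it serve as the form [f] of the matrix recurrences. *)
Definition col_sum d (j : 'I_d) (M : 'M[R[i]]_d) : R[i] := \sum_k M k j.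

Fact col_sum_is_linear d (j : 'I_d) : scalar (col_sum j).
Proof.
move=> a X Y; rewrite /col_sum mulr_sumr -big_split /=.
by apply: eq_bigr => k _; rewrite !mxE.
Qed.

HB.instance Definition _ d (j : 'I_d) :=
  GRing.isLinear.Build R[i] 'M[R[i]]_d R[i] *%R (col_sum j) (col_sum_is_linear j).

Lemma char_poly_split d (M : 'M[R[i]]_d) : exists2 zs,
  char_poly M = \prod_(z <- zs) ('X - z%:P) & forall z, z \in zs -> eigenvalue M z.
Proof.
have [zs /=] := closed_field_poly_normal (char_poly M).
rewrite (monicP (char_poly_monic M)) scale1r => Mzs; exists zs => // z zzs.
by rewrite eigenvalue_root_char Mzs root_prod_XsubC.
Qed.

Lemma eigenvalueZ d (M : 'M[R[i]]_d) (a mu : R[i]) : a != 0 ->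
  eigenvalue (a^-1 *: M) mu -> eigenvalue M (mu * a).
Proof.
move=> a0 /eigenvalueP[v vM v0]; apply/eigenvalueP; exists v => //.
by rewrite mulrC -scalerA -vM -scalemxAr scalerA divff // scale1r.
Qed.

Lemma col_sum_expr_growth d (M : 'M[R[i]]_d) lam j g :
  PF_eigenvalue M lam -> lam%:C < g ->
  geom_bounded g (fun n => col_sum j (M ^+ n)).
Proof.
case: d M j => [|d'] M j [lam0 _ lamM] lamg; first by case: j.
have [zs Mzs zsM] := char_poly_split M.
apply: (@geom_bounded_rec_ops _ zs).
- by apply: le_lt_trans lamg; rewrite ler0c.
- by move=> z /zsM /lamM zl; left; apply: le_lt_trans lamg.
have := rec_ops_char_poly (col_sum j) 1 0 Mzs.
rewrite (eq_map (@expr1 _)) map_id => <-; congr rec_ops; apply/funext => n.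
by rewrite mul1n addn0.
Qed.

(** Here [rho] bounds the eigenvalues of modulus below [lam]. One step of w is h steps of the matrix
    power, hence the rate g^h. *)
Lemma col_sum_expr_decay d (M : 'M[R[i]]_d) lam (rho : R[i]) (h i : nat) j
    (p : {poly R[i]}) g :
    PF_eigenvalue M lam -> 0 < lam -> (0 < h)%N ->
    (forall mu, eigenvalue M mu -> `|mu| < lam%:C -> `|mu| <= rho) ->
    0 < g < 1 -> rho / lam%:C < g ->
    let w n := col_sum j ((lam%:C^-1 *: M) ^+ (h * n + i)) - p.[n%:R] in
  w @ \oo --> 0 -> geom_bounded (g ^+ h) w.
Proof.
case: d M j => [|d'] M j; first by case: j.
move=> [_ _ lamM] lam0 h0 rhoM /andP[g0 g1] rhog w w0.
have lamC0 : 0 < lam%:C by rewrite (ltcR 0).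
have [zs Nzs zsN] := char_poly_split (lam%:C^-1 *: M).
have [q qE] := rec_ops_poly [seq z ^+ h | z <- zs] p.
(* The factors E - z^h kill the matrix part and turn p into a polynomial q, which [size q] further
   factors E - 1 kill. *)
apply: (@geom_bounded_rec_ops _ ([seq z ^+ h | z <- zs] ++ nseq (size q) 1)).
- exact: exprn_gt0.
- move=> y; have gh1 : g ^+ h < 1 by rewrite exprn_ilt1 ?ltW // -lt0n.
  rewrite mem_cat => /orP[/mapP[z /zsN zN ->]|/nseqP[-> _]]; last first.
    by right; rewrite normr1.
  have Mz := eigenvalueZ (lt0r_neq0 lamC0) zN.
  (* The scaled eigenvalue z has modulus at most 1. At modulus 1 the convergence of w to 0 is used;
     below 1, |z| <= rho / lam < g. *)
  have := lamM _ Mz; rewrite normrM (gtr0_norm lamC0) -ler_pdivlMr // divff ?gt_eqF //.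
  rewrite le_eqVlt normrX => /orP[/eqP ->|z1].
    by right; rewrite expr1n.
  left; rewrite ltrXn2r // ?lt0n_neq0 ?ltW //.
  apply: le_lt_trans rhog; rewrite ler_pdivlMr // -[X in _ * X](gtr0_norm lamC0) -normrM.
  by apply: rhoM => //; rewrite normrM (gtr0_norm lamC0) gtr_pMl.
rewrite /rec_ops foldl_cat -!/(rec_ops _ _) rec_opsB rec_ops_char_poly // qE.
have -> : (fun n => 0 - q.[n%:R]) = fun n => (- q).[n%:R].
  by apply/funext => n; rewrite hornerN sub0r.
by apply: rec_ops_poly0; rewrite size_polyN.
Qed.
End SpectralBounds.

(** * Roots of unity and the closed form of a(n) *)

Section RootsOfUnity.
Variable R : realType.

Lemma expiX (t : R) n : expi t ^+ n = expi (t * n%:R).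
Proof.
elim: n => [|n IH]; first by rewrite mulr0 /expi cos0 sin0.
rewrite exprS IH /expi -natr1 mulrDr mulr1 addrC cosD sinD.
by apply/eqP; rewrite eq_complex /=; apply/andP; split; apply/eqP; ring.
Qed.

(** The real part is cos t = 1 - 2 sin^2(t/2), and sin is positive on (0, pi). *)
Lemma expi_neq1 (t : R) : 0 < t < 2 * pi -> expi t != 1.
Proof.
move=> /andP[t0 t2]; apply/eqP => /(congr1 (@complex.Re R)) /= cos1.
have sin0 : 0 < sin (t / 2).
  by rewrite sin_gt0_pi // divr_gt0 //= ltr_pdivrMr // mulrC.
have : 0 < sin (t / 2) ^+ 2 by rewrite exprn_gt0.
move: cos1; rewrite [in cos t](_ : t = (t / 2) *+ 2); last by rewrite -mulr_natr divfK.
by rewrite cos_mulr2n cos2sin2; lra.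
Qed.

(** The order m divides h; were m < h, the angle 2 pi m / h would lie strictly between 0 and 2 pi,
    so the m-th power would not be 1. *)
Lemma expi_prim_root (h : nat) : (0 < h)%N ->
  h.-primitive_root (expi (2 * pi / h%:R : R)).
Proof.
move=> h0; set z := expi _.
have hR : (h%:R : R) != 0 by rewrite pnatr_eq0 -lt0n.
have zh : z ^+ h = 1.
  rewrite expiX mulfVK // /expi -[2 * pi]mulrC.
  by rewrite mulr_natr cos2pi sin2pi.
have [m zm mh] := prim_order_exists h0 zh.
have [<- //|nmh] := eqVneq m h.
have mlt : (m < h)%N by rewrite ltn_neqAle nmh dvdn_leq.
have := prim_expr_order zm; rewrite expiX => /eqP; apply: contraTT => _.
apply: expi_neq1; rewrite !mulr_gt0 ?pi_gt0 ?invr_gt0 ?ltr0n ?(prim_order_gt0 zm) //=.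
rewrite -mulrA gtr_pMr ?mulr_gt0 ?pi_gt0 // mulrC ltr_pdivrMr ?ltr0n // mul1r.
by rewrite ltr_nat.
Qed.

(** A geometric sum in x = z^(m-n): x^h = 1, and x = 1 exactly when m and n agree mod h. *)
Lemma sum_prim_root (F : fieldType) (h m n : nat) (z : F) : h.-primitive_root z ->
  \sum_(i < h) z ^ (i%:Z * (m%:Z - n%:Z)) = if m == n %[mod h] then h%:R else 0.
Proof.
move=> zP; have h0 := prim_order_gt0 zP.
have z0 : z != 0.
  apply: contraTneq (oner_neq0 F) => z0.
  by rewrite -(prim_expr_order zP) z0 expr0n eqn0Ngt h0 eqxx.
pose x := z ^+ m / z ^+ n.
have xE (i : nat) : z ^ (i%:Z * (m%:Z - n%:Z)) = x ^+ i.
  by rewrite mulrC -exprz_exp expfzDr // -exprnN.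
under eq_bigr do rewrite xE.
have zn0 : z ^+ n != 0 by rewrite expf_neq0.
have -> : (m == n %[mod h]) = (x == 1).
  by rewrite -(eq_prim_root_expr zP) -(can_eq (mulfK zn0)) mul1r /x mulfVK.
have [->|x1] := eqVneq x 1.
  by under eq_bigr do rewrite expr1n; rewrite sumr_const card_ord.
apply/eqP; rewrite -(mulrI_eq0 _ (@mulfI _ (x - 1) _)) ?subr_eq0 // -subrX1.
rewrite /x exprMn exprVn -!exprM ![(_ * h)%N]mulnC !exprM (prim_expr_order zP).
by rewrite !expr1n divr1 subrr.
Qed.

(** By orthogonality of the roots of unity only j = n mod h survives, with a factor h that cancels
    1/h. *)
Lemma asymp_seqE d lam (h : nat) (h0 : (0 < h)%N)
    (S : 'I_h -> 'M[{poly R[i]}]_d) j0 n :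
  asymp_seq lam S j0 n =
  lam%:C ^+ n * col_sum_at (S (Ordinal (ltn_pmod n h0))) j0 (n %/ h).
Proof.
rewrite /asymp_seq; congr (_ * _); rewrite exchange_big /=.
have hC : (h%:R : R[i]) != 0 by rewrite pnatr_eq0 -lt0n.
under eq_bigr do rewrite -mulr_sumr (sum_prim_root _ _ (expi_prim_root h0)).
rewrite (bigD1 (Ordinal (ltn_pmod n h0))) //= modn_mod eqxx big1 ?addr0.
  by rewrite mulrCA mulVf // mulr1.
move=> j jn; case: ifP => [|_]; last exact: mulr0.
rewrite (modn_small (ltn_ord j)) => /eqP nj; case/eqP: jn.
exact/val_inj.
Qed.
End RootsOfUnity.

(** * Powers in the based algebra versus powers of the action matrix *)

Section BasedAlgebraTheory.
Variables (R : realType) (K : subringClosed R[i]) (A : basedAlgebra K).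
Implicit Types (x y c : A).

Local Notation coef x k := (val (ba_coord x k) : R[i]).

Lemma ba_coord_sumZ (I : finType) (a : I -> subring_of K) (y : I -> A) k :
  ba_coord (\sum_i a i *: y i) k = \sum_i a i * ba_coord (y i) k.
Proof.
have -> : \sum_i a i *: y i =
    \sum_l (\sum_i a i * ba_coord (y i) l) *: ba_basis A l.
  under [in RHS]eq_bigr do rewrite scaler_suml.
  rewrite exchange_big /=; apply: eq_bigr => i _.
  by under eq_bigr do rewrite -scalerA; rewrite -scaler_sumr -ba_coordK.
by rewrite ba_coord_sum.
Qed.

Lemma ba_coordMl x y k :
  ba_coord (x * y) k = \sum_i ba_coord x i * ba_coord (ba_basis A i * y) k.
Proof.
rewrite {1}[x]ba_coordK mulr_suml; under eq_bigr do rewrite -scalerAl.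
exact: ba_coord_sumZ.
Qed.

Lemma ba_coordMr x y k :
  ba_coord (x * y) k = \sum_j ba_coord y j * ba_coord (x * ba_basis A j) k.
Proof.
rewrite {1}[y]ba_coordK mulr_sumr; under eq_bigr do rewrite -scalerAr.
exact: ba_coord_sumZ.
Qed.

Lemma ba_coord_basis j k : ba_coord (ba_basis A j) k = (k == j)%:R.
Proof.
rewrite -[ba_basis A j](_ : \sum_i (i == j)%:R *: ba_basis A i = _).
  by rewrite ba_coord_sum.
rewrite (bigD1 j) //= eqxx scale1r big1 ?addr0 // => i /negbTE ->.
exact: scale0r.
Qed.

Lemma pre_action_mxE c k j : pre_action_mx c k j = coef (c * ba_basis A j) k.
Proof. by rewrite mxE ba_coordMl. Qed.

Lemma ba_coord_pre_action c x k :
  coef (c * x) k = \sum_j pre_action_mx c k j * coef x j.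
Proof.
rewrite ba_coordMr rmorph_sum; apply: eq_bigr => j _.
by rewrite pre_action_mxE rmorphM mulrC.
Qed.

Lemma component1_edge c k l : l \in component1 c -> pre_action_mx c k l != 0 ->
  k \in component1 c.
Proof.
rewrite !inE => /connect_trans + kl; apply; apply: connect1.
by rewrite /edge_sym kl orbT.
Qed.

(** The span of the component of 1 is stable under left multiplication by c, because no nonzero
    entry links the component to its complement. Restricting to the component therefore loses
    nothing. *)
Lemma ba_coord_expM_notin c n (j : 'I_#|component1 c|) k : k \notin component1 c ->
  coef (c ^+ n * ba_basis A (enum_val j)) k = 0.
Proof.
elim: n k => [|n IH] k kc.
  rewrite expr0 mul1r ba_coord_basis (_ : (k == _) = false) //.
  by apply: contraNF kc => /eqP ->; apply: enum_valP.
rewrite exprS -mulrA ba_coord_pre_action big1 // => l _.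
have [lc|/IH ->] := boolP (l \in component1 c); last exact: mulr0.
have [->|kl] := eqVneq (pre_action_mx c k l) 0; first exact: mul0r.
by rewrite (component1_edge lc kl) in kc.
Qed.

Lemma action_mxX c n k j :
  (action_mx c ^+ n) k j = coef (c ^+ n * ba_basis A (enum_val j)) (enum_val k).
Proof.
elim: n k => [|n IH] k.
  rewrite !expr0 mul1r ba_coord_basis mxE (inj_eq enum_val_inj).
  by case: eqP.
rewrite !exprS -mulrA ba_coord_pre_action mxE.
rewrite (bigID [pred l | l \in component1 c]) /= [X in _ + X]big1 ?addr0.
  by rewrite [in RHS]big_enum_val; apply: eq_bigr => l _; rewrite mxE IH.
by move=> l lc; rewrite ba_coord_expM_notin ?mulr0.
Qed.

Lemma col_sum_action_mxX c n j :
  col_sum j (action_mx c ^+ n) = \sum_k coef (c ^+ n * ba_basis A (enum_val j)) k.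
Proof.
rewrite (bigID [pred l | l \in component1 c]) /= [X in _ + X]big1 ?addr0.
  by rewrite [in RHS]big_enum_val; apply: eq_bigr => l _; rewrite action_mxX.
by move=> l lc; rewrite ba_coord_expM_notin.
Qed.

Lemma pow_coord_sumE c n :
  pow_coord_sum c n = col_sum (action_idx1 c) (action_mx c ^+ n).
Proof.
rewrite col_sum_action_mxX enum_rankK_in ?component1_ord0 //.
by rewrite ba_basis0 mulr1 -rmorph_sum.
Qed.

Lemma ba_coordM_ge0 x y : (forall k, 0 <= coef x k) -> (forall k, 0 <= coef y k) ->
  forall k, 0 <= coef (x * y) k.
Proof.
move=> x0 y0 k; rewrite ba_coordMl rmorph_sum; apply: sumr_ge0 => i _.
rewrite rmorphM; apply: mulr_ge0; first exact: x0.
rewrite ba_coordMr rmorph_sum; apply: sumr_ge0 => j _.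
by rewrite rmorphM; apply: mulr_ge0; [apply: y0 | apply: ba_coord_ge0].
Qed.

Lemma ba_coord_basis_ge0 j k : 0 <= coef (ba_basis A j) k.
Proof. by rewrite ba_coord_basis; case: (k == j). Qed.

Lemma ba_coordX_ge0 c n : (forall k, 0 <= coef c k) -> forall k, 0 <= coef (c ^+ n) k.
Proof.
move=> c0; elim: n => [|n IH].
  by rewrite expr0 -ba_basis0; apply: ba_coord_basis_ge0.
by rewrite exprS; apply: ba_coordM_ge0.
Qed.

Lemma pow_coord_sum_ge0 c n : (forall k, 0 <= coef c k) -> 0 <= pow_coord_sum c n.
Proof.
by move=> c0; rewrite /pow_coord_sum rmorph_sum sumr_ge0 // => k _; apply: ba_coordX_ge0.
Qed.

(** The sum of all structure constants is a crude bound, but uniform in x and j. *)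
Lemma sum_ba_coordM_basis : exists2 B : R[i], 0 <= B &
  forall x j, (forall k, 0 <= coef x k) ->
    \sum_k coef (x * ba_basis A j) k <= B * \sum_k coef x k.
Proof.
pose m i j k := coef (ba_basis A i * ba_basis A j) k.
have m0 i j k : 0 <= m i j k by apply: ba_coord_ge0.
exists (\sum_i \sum_j \sum_k m i j k) => [|x j x0].
  by do 3![apply: sumr_ge0 => ? _].
under eq_bigr do rewrite ba_coordMl rmorph_sum.
rewrite exchange_big mulr_sumr; apply: ler_sum => i _.
under eq_bigr do rewrite rmorphM; rewrite -mulr_sumr mulrC.
apply: ler_wpM2r; first exact: x0.
rewrite [leRHS](bigD1 i) //= [X in _ <= X + _](bigD1 j) //= -addrA lerDl addr_ge0 //.
  by do 2![apply: sumr_ge0 => ? _].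
by do 3![apply: sumr_ge0 => ? _].
Qed.

(* All columns of [action_mx c ^+ n] have sums bounded by that of the column of
   1, because right multiplication by a basis element is bounded; pairing with
   a left eigenvector turns this into a lower bound for that column. *)
Lemma pow_coord_sum_lower c lam : (forall k, 0 <= coef c k) ->
  0 <= lam -> eigenvalue (action_mx c) lam%:C ->
  exists2 kappa : R[i], 0 < kappa & forall n, kappa * lam%:C ^+ n <= pow_coord_sum c n.
Proof.
move=> c0 lam0 /eigenvalueP[v vM v0].
have [B B0 HB] := sum_ba_coordM_basis.
have [j vj] : exists j, v ord0 j != 0 by apply/rV0Pn.
pose V := \sum_k `|v ord0 k|.
have V0 : 0 <= V by apply: sumr_ge0.
have D0 : 0 < V * B + 1 by rewrite ltr_wpDl ?mulr_ge0.
have vMn n : v *m action_mx c ^+ n = lam%:C ^+ n *: v.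
  elim: n => [|n IH]; first by rewrite !expr0 mulmx1 scale1r.
  by rewrite exprS mulmxA vM -scalemxAl IH scalerA -exprS.
(* From lam^n |v_j| = |(v M^n)_j| <= V * (column sum j of M^n) <= V B b(n); the added 1 keeps the
   denominator positive. *)
exists (`|v ord0 j| / (V * B + 1)) => [|n]; first by rewrite divr_gt0 ?normr_gt0.
rewrite mulrAC ler_pdivrMr // mulrC.
have lamC0 : 0 <= lam%:C by rewrite ler0c.
have b0 := pow_coord_sum_ge0 n c0.
rewrite -[lam%:C ^+ n]ger0_norm ?exprn_ge0 // -normrM.
have -> : lam%:C ^+ n * v ord0 j = (v *m action_mx c ^+ n) ord0 j.
  by rewrite vMn mxE.
rewrite mxE; apply: le_trans (ler_norm_sum _ _ _) _.
have Mn0 k : 0 <= (action_mx c ^+ n) k j.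
  by rewrite action_mxX; apply: ba_coordM_ge0 => ?;
     [apply: ba_coordX_ge0 | apply: ba_coord_basis_ge0].
apply: (@le_trans _ _ (V * col_sum j (action_mx c ^+ n))).
  rewrite mulr_suml; apply: ler_sum => k _; rewrite normrM ler_wpM2l //.
  rewrite ger0_norm // /col_sum (bigD1 k) //= lerDl sumr_ge0 //.
rewrite col_sum_action_mxX mulrDr mulr1 ler_wpDr // mulrCA ler_wpM2l //.
by rewrite mulrC; apply: le_trans (HB _ _ (ba_coordX_ge0 n c0)) _; rewrite -rmorph_sum.
Qed.
End BasedAlgebraTheory.

(** * Limits of complex sequences: residue classes, roots and quotients *)

Section ComplexSequences.
Variable R : realType.
Implicit Types (u b : nat -> R[i]) (x y lam : R) (B : R[i]).

Lemma ge0_complexRe (z : R[i]) : 0 <= z -> z = (complex.Re z)%:C.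
Proof. by move=> z0; rewrite RRe_real // ger0_real. Qed.

(** Any constant is absorbed by a strict increase of the base, as B (x/y)^n tends to 0. *)
Lemma near_le_exprn B x y : 0 <= B -> 0 <= x < y ->
  \forall n \near \oo, B * x%:C ^+ n <= y%:C ^+ n.
Proof.
move=> /ge0_complexRe -> /andP[x0 xy]; have y0 : 0 < y by exact: le_lt_trans xy.
have q1 : `|x / y| < 1.
  by rewrite ger0_norm ?(divr_ge0 x0 (ltW y0)) // ltr_pdivrMr ?mul1r.
have /cvgrPdist_lt/(_ _ ltr01) := cvg_geometric (complex.Re B) q1.
apply: filterS => n; rewrite sub0r normrN /= => /ltW/(le_trans (ler_norm _)).
rewrite expr_div_n mulrA ler_pdivrMr ?exprn_gt0 // mul1r.
by rewrite -!rmorphXn -rmorphM lecR.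
Qed.

Lemma cvg0_residues (h : nat) u : (0 < h)%N ->
  (forall i : 'I_h, (fun n => u (h * n + i)%N) @ \oo --> 0) -> u @ \oo --> 0.
Proof.
move=> h0 uh; apply/cvgrPdist_lt => e e0.
have : \forall m \near \oo, forall i : 'I_h, `|0 - u (h * m + i)%N| < e.
  by apply: filter_forall => i; move/cvgrPdist_lt : (uh i) => /(_ _ e0).
move=> [N _ HN]; exists (N * h)%N => // n /=; rewrite -leq_divRL // => /HN.
by move=> /(_ (Ordinal (ltn_pmod n h0))) /=; rewrite mulnC -divn_eq.
Qed.

Lemma cvg_rootC_expr b lam : 0 < lam -> (forall n, 0 <= b n) ->
  (exists2 kappa : R[i], 0 < kappa & forall n, kappa * lam%:C ^+ n <= b n) ->
  (forall g : R[i], lam%:C < g -> geom_bounded g b) ->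
  (fun n => n.-root (b n)) @ \oo --> lam%:C.
Proof.
move=> lam0 b0 [kappa k0 bk] bg; apply/cvgrPdist_lt => e e0.
rewrite (ge0_complexRe (ltW e0)); set r := complex.Re e.
have {e0}r0 : 0 < r by rewrite -(ltcR 0) -(ge0_complexRe (ltW e0)).
have lu : lam < lam + r / 4 by rewrite ltrDl divr_gt0.
(* The gap between lam + r/4 and lam + r/2 absorbs the constant [B]. *)
have [B bB] := bg (lam + r / 4)%:C (etrans (ltcR _ _) lu).
have B0 : 0 <= B by have := bB 0; rewrite expr0 mulr1; apply: le_trans.
have up : \forall n \near \oo, B * (lam + r / 4)%:C ^+ n <= (lam + r / 2)%:C ^+ n.
  by apply: near_le_exprn => //; lra.
(* The maximum keeps the base nonnegative, as comparing n-th roots requires; the gap between l and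
   lam absorbs [kappa]. *)
pose l := Num.max 0 (lam - r / 2).
have l0 : 0 <= l by rewrite le_max lexx.
have llam : l < lam by rewrite gt_max lam0 /=; lra.
have lr : lam - r < l by rewrite lt_max; apply/orP; right; lra.
have lo : \forall n \near \oo, kappa^-1 * l%:C ^+ n <= lam%:C ^+ n.
  by apply: near_le_exprn; [rewrite invr_ge0 ltW | rewrite l0].
near=> n.
have n0 : (0 < n)%N by near: n; exact: nbhs_infty_gt.
have lC0 : 0 <= l%:C by rewrite ler0c.
have uC0 : 0 <= (lam + r / 2)%:C by rewrite ler0c; lra.
have low : l%:C <= n.-root (b n).
  rewrite -(exprCK n0 lC0) ler_rootC ?nnegrE ?exprn_ge0 //.
  apply: le_trans (bk n); rewrite mulrC -ler_pdivrMr // mulrC; near: n.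
  exact: lo.
have upp : n.-root (b n) <= (lam + r / 2)%:C.
  rewrite -(exprCK n0 uC0) ler_rootC ?nnegrE ?exprn_ge0 //.
  apply: le_trans (_ : B * (lam + r / 4)%:C ^+ n <= _); last by near: n.
  by rewrite -[b n]ger0_norm.
have rE := ge0_complexRe (le_trans lC0 low).
rewrite rE !lecR in low upp *.
rewrite rE -rmorphB real_ltr_norml ?complex_real // -rmorphN !ltcR.
by apply/andP; split; lra.
Unshelve. all: by end_near.
Qed.

(** Once |t - s| < kappa/2, the bound t >= kappa gives |s| >= kappa/2, and t/s - 1 = (t - s)/s. *)
Lemma near_dist_ratio (t s : nat -> R[i]) (kappa : R[i]) : 0 < kappa ->
  (forall n, kappa <= t n) -> (fun n => t n - s n) @ \oo --> 0 ->
  \forall n \near \oo, `|t n / s n - 1| <= 2 / kappa * `|t n - s n|.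
Proof.
move=> k0 kt /cvgrPdist_lt /(_ (kappa / 2)); rewrite divr_gt0 // => /(_ isT).
apply: filterS => n; rewrite sub0r normrN => ts.
have sk : kappa / 2 <= `|s n|.
  have : kappa <= `|s n| + `|t n - s n|.
    apply: le_trans (kt n) _; rewrite -[leLHS](ger0_norm (le_trans (ltW k0) (kt n))).
    by rewrite -{1}[t n](subrK (s n)) addrC ler_normD.
  move=> H; rewrite -(lerD2r `|t n - s n|); apply: le_trans H.
  by rewrite [leRHS](splitr kappa) lerD2l ltW.
have s0 : 0 < `|s n| by apply: lt_le_trans sk; rewrite divr_gt0.
rewrite -[X in _ - X](@divff _ (s n)) -?normr_gt0 // -mulrBl normrM normfV mulrC.
by rewrite ler_wpM2r // -invf_div lef_pV2 // posrE divr_gt0.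
Qed.

End ComplexSequences.

(** * Limit polynomials and the final assembly *)

Lemma PF_period_gt0 (hs : seq nat) : all (leq 1) hs -> (0 < PF_period hs)%N.
Proof.
rewrite /PF_period; elim: hs => [|l hs IH] /=; first by rewrite big_nil.
by move=> /andP[l0 /IH hs0]; rewrite big_cons lcmn_gt0 l0.
Qed.

Lemma PF_limit_polys_col_sum (R : realType) (d : nat) (M : 'M[R[i]]_d) lam nu h
    (S : 'I_h -> 'M[{poly R[i]}]_d) (j : 'I_d) (i : 'I_h) :
  PF_limit_polys M lam nu S ->
  (fun n => col_sum j ((lam%:C^-1 *: M) ^+ (h * n + i)) - col_sum_at (S i) j n)
    @ \oo --> 0.
Proof.
move=> SP; pose D k n := ((lam%:C^-1 *: M) ^+ (h * n + i)) k j - (S i k j).[n%:R].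
have D0 k : D k @ \oo --> 0 by have [_ H] := SP i k j; apply: norm_cvg0 H.
rewrite (_ : (fun n => _) = fun n => \sum_k D k n); last first.
  by apply/funext => n; rewrite sumrB.
elim: (index_enum _) => [|k r IH].
  rewrite (_ : (fun n => _) = fun=> 0); first exact: cvg_cst.
  by apply/funext => n; rewrite big_nil.
rewrite (_ : (fun n => _) = fun n => D k n + \sum_(l <- r) D l n); last first.
  by apply/funext => n; rewrite big_cons.
rewrite -[X in _ --> X](addr0 0); exact: cvgD (D0 k) IH.
Qed.

Theorem theorem8 (R : realType) (K : subringClosed R[i]) (A : basedAlgebra K)
    (c : A) (c_ge0 : forall i, 0 <= (ba_coord c i : R[i]))
    (lam : R) (lamPF : PF_eigenvalue (action_mx c) lam) (lam_gt0 : 0 < lam)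
    (hs : seq nat) (hsP : PF_periods (action_mx c) lam hs)
    (nu : nat) (nuP : max_jordan_dim (action_mx c) lam%:C nu)
    (S : 'I_(PF_period hs) -> 'M[{poly R[i]}]_#|component1 c|)
    (SP : PF_limit_polys (action_mx c) lam nu S) :
  let a := asymp_seq lam S (action_idx1 c) in
  [/\ asymp_equiv (pow_coord_sum c) a,
      forall lsec : R[i], second_eigenvalue (action_mx c) lam lsec ->
        cvg_geometrically (fun n => pow_coord_sum c n / a n) 1
          `|lsec / lam%:C|
    & (fun n => n.-root (pow_coord_sum c n)) @ \oo --> lam%:C].
Proof.
move=> a; have [lam0 lamE lamM] := lamPF; case: hsP => _ hs1 _.
have h0 := PF_period_gt0 hs1; set h := PF_period hs in S SP a h0 *.
set j0 := action_idx1 c in a *; set M := action_mx c in lamPF lamE lamM SP *.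
have lamC0 : 0 < lam%:C by rewrite (ltcR 0).
have b0 n : 0 <= pow_coord_sum c n by apply: pow_coord_sum_ge0.
have [kappa k0 bk] := pow_coord_sum_lower c_ge0 lam0 lamE.
pose t n := col_sum j0 ((lam%:C^-1 *: M) ^+ n).
pose s n := col_sum_at (S (Ordinal (ltn_pmod n h0))) j0 (n %/ h).
have tE n : t n = pow_coord_sum c n / lam%:C ^+ n.
  rewrite /t pow_coord_sumE (_ : (_ *: M) ^+ n = lam%:C ^- n *: M ^+ n).
    by rewrite linearZ /= mulrC.
  elim: n => [|n IH]; first by rewrite !expr0 invr1 scale1r.
  rewrite !exprS IH; rewrite -[LHS]/((_ *: M) *m (_ *: M ^+ n)).
  by rewrite -scalemxAl -scalemxAr scalerA invfM.
have abE n : pow_coord_sum c n / a n = t n / s n.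
  by rewrite tE /a asymp_seqE invfM mulrA.
have tk n : kappa <= t n by rewrite tE ler_pdivlMr ?exprn_gt0.
have sE (i : 'I_h) n : s (h * n + i)%N = col_sum_at (S i) j0 n.
  rewrite /s mulnC divnMDl // divn_small ?addn0 //; congr (col_sum_at (S _) _ _).
  by apply: val_inj; rewrite /= modnMDl modn_small.
have u0 : (fun n => t n - s n) @ \oo --> 0.
  apply: (cvg0_residues h0) => i; under eq_fun do rewrite sE.
  exact: PF_limit_polys_col_sum SP.
have dist := near_dist_ratio k0 tk u0.
split.
- rewrite /asymp_equiv; apply/cvgrPdist_lt => e e0.
  have e'0 : 0 < e / (2 / kappa) by rewrite !divr_gt0.
  move/cvgrPdist_lt : u0 => /(_ _ e'0); move: dist; apply: filterS2 => n.
  rewrite sub0r normrN abE distrC => /le_lt_trans + H; apply.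
  by rewrite -ltr_pdivlMl ?divr_gt0 // mulrC.
- move=> lsec lsecP; rewrite normrM normfV (gtr0_norm lamC0).
  have lsec1 : `|lsec| < lam%:C by case: lsecP => [[]//|[-> _]]; rewrite normr0.
  split.
    by rewrite divr_ge0 ?(ltW lamC0) //= ltr_pdivrMr ?mul1r.
  move=> g /andP[lg g1].
  have g0 : 0 < g by apply: le_lt_trans lg; rewrite divr_ge0 // ltW.
  have : geom_bounded g (fun n => t n - s n).
    apply: (geom_bounded_residues h0 g0) => i.
    (* On a fixed residue class s is the evaluation of a single polynomial, the column sum of
       [S i]. *)
    have -> : (fun n => t (h * n + i)%N - s (h * n + i)%N) =
        fun n => t (h * n + i)%N - (\sum_k S i k j0).[n%:R].
      by apply/funext => n; rewrite sE horner_sum.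
    apply: (col_sum_expr_decay lamPF lam_gt0 h0 _ _ lg); rewrite ?g0 //.
      (* Take rho = |lsec|: either it is maximal below lam, or no eigenvalue lies below lam and the
         bound is vacuous. *)
      by move=> mu muM mul; case: lsecP => [[_ _]|[_ /(_ _ muM)]//]; apply.
    under eq_fun do rewrite horner_sum.
    exact: PF_limit_polys_col_sum SP.
  move=> [B uB]; exists (2 / kappa * B); split.
    have B0 : 0 <= B by have := uB 0; rewrite expr0 mulr1; apply: le_trans.
    by rewrite ger0_real // mulr_ge0 // divr_ge0 // ltW.
  move=> X BX; move: dist; apply: filterS => n /= H.
  apply: le_trans (ltW BX); rewrite abE normrM normfV normrX (gtr0_norm g0).
  rewrite ler_pdivrMr ?exprn_gt0 //; apply: le_trans H _.
  by rewrite -[leRHS]mulrA ler_wpM2l // divr_ge0 // ltW.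
- apply: cvg_rootC_expr => //; first by exists kappa.
  move=> g lg; have [B HB] := col_sum_expr_growth j0 lamPF lg.
  by exists B => n; rewrite pow_coord_sumE.
Qed.
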